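(* Every standard multigraph $M$ on $n$ vertices with $\delta(M)\ge\frac{3n-3}{2}$ contains $\lfloor\frac{n}{3}\rfloor$ pairwise vertex-disjoint $5$-triangles.
   Context: Multigraphs have no loops; $\mu(x,y)$ is the number of edges with ends $x,y$; $M$ is standard if $\mu(x,y)\le2$ for all $x,y$; $d(x)=\sum_y\mu(x,y)$ and $\delta(M)=\min_x d(x)$. A $5$-triangle is a multigraph on three vertices containing a triangle $C_3$ and having exactly $5$ edges counted with multiplicity; $M$ contains a $5$-triangle on $\{x,y,z\}$ iff $x,y,z$ are pairwise adjacent and $\mu(x,y)+\mu(y,z)+\mu(x,z)\ge5$. *)

(* Defs.v *)
From mathcomp Require Import all_boot all_order all_algebra.
From mathcomp Require Import zify.

Set Implicit Arguments.
Unset Strict Implicit.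
Unset Printing Implicit Defensive.

(* A loopless multigraph with vertex set V, given by its edge multiplicities. *)
Record multigraph (V : finType) := Multigraph {
  mult :> V -> V -> nat;
  multC : forall x y, mult x y = mult y x;
  mult_irr : forall x, mult x x = 0
}.

Definition standard (V : finType) (M : multigraph V) : Prop :=
  forall x y, M x y <= 2.

Definition adjacent (V : finType) (M : multigraph V) (x y : V) : bool :=
  0 < M x y.

Definition degree (V : finType) (M : multigraph V) (x : V) : nat :=
  \sum_(y : V) M x y.

(* The base value of the iterated minimum is the maximum degree, so it has no
   effect when V is nonempty; when V is empty the result is 0. *)
Definition min_degree (V : finType) (M : multigraph V) : nat :=
  \big[minn / \max_(x : V) degree M x]_(x : V) degree M x.

(* Half the sum over ordered pairs; the sum is even since M is symmetric and
   has no loops. *)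
Definition nb_edges (V : finType) (M : multigraph V) : nat :=
  (\sum_(x : V) \sum_(y : V) M x y)./2.

Definition contains_triangle (V : finType) (M : multigraph V) : Prop :=
  exists x y z : V, [&& adjacent M x y, adjacent M y z & adjacent M x z].

Definition five_triangle (V : finType) (H : multigraph V) : Prop :=
  [/\ #|V| = 3, contains_triangle H & nb_edges H = 5].

(* M has a sub-multigraph with vertex set S that is a 5-triangle. *)
Definition contains_five_triangle_on
    (V : finType) (M : multigraph V) (S : {set V}) : Prop :=
  exists H : multigraph {x : V | x \in S},
    five_triangle H /\ forall u v, H u v <= M (val u) (val v).

Definition contains_disjoint_five_triangles
    (V : finType) (M : multigraph V) (k : nat) : Prop :=
  exists P : {set {set V}},
    [/\ #|P| = k, trivIset P &
        forall S, S \in P -> contains_five_triangle_on M S].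

Lemma min_degree_le (V : finType) (M : multigraph V) (x : V) :
  min_degree M <= degree M x.
Proof.
rewrite /min_degree; move: (\max_(y : V) _) (mem_index_enum x) => m.
elim: (index_enum V) => [//|a s IH]; rewrite inE big_cons geq_min.
by case/predU1P => [<-|/IH ->]; rewrite ?leqnn ?orbT.
Qed.

Lemma min_degree_attained (V : finType) (M : multigraph V) :
  0 < #|V| -> exists x, min_degree M = degree M x.
Proof.
move=> V0; rewrite /min_degree.
apply: (big_ind (fun m => exists x, m = degree M x)) => [||x _]; last by exists x.
- by have [x ->] := eq_bigmax (degree M) V0; exists x.
- by move=> _ _ [x ->] [y ->]; case: leqP => _; [exists x | exists y].
Qed.

Lemma mem_uniq3 (T : finType) (x y z : T) :
  #|T| = 3 -> uniq [:: x; y; z] -> forall t, t \in [:: x; y; z].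
Proof.
move=> T3 U t; have [|| _ ->] := @uniq_min_size _ _ (enum T) U.
- by move=> u _; rewrite mem_enum.
- by rewrite -cardE T3.
by rewrite mem_enum.
Qed.

Lemma nb_edges3 (T : finType) (H : multigraph T) (x y z : T) :
  #|T| = 3 -> uniq [:: x; y; z] -> nb_edges H = H x y + H y z + H x z.
Proof.
move=> T3 U.
have S F : \sum_(t : T) F t = F x + (F y + F z) :> nat.
  have E : perm_eq (index_enum T) [:: x; y; z].
    rewrite uniq_perm ?index_enum_uniq // => t.
    by rewrite mem_index_enum mem_uniq3.
  by rewrite (perm_big _ E) !big_cons big_nil /= addn0.
rewrite /nb_edges !S !mult_irr (multC H y x) (multC H z x) (multC H z y).
lia.
Qed.

Lemma contains_five_triangle_onP (V : finType) (M : multigraph V) (x y z : V) :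
  contains_five_triangle_on M [set x; y; z] <->
  [/\ adjacent M x y, adjacent M y z, adjacent M x z &
      5 <= M x y + M y z + M x z].
Proof.
have nq (T : finType) (H : multigraph T) u v : adjacent H u v -> u != v.
  by rewrite /adjacent; apply: contraTneq => ->; rewrite mult_irr.
set S := [set x; y; z].
have xS : x \in S by rewrite !inE eqxx.
have yS : y \in S by rewrite !inE eqxx orbT.
have zS : z \in S by rewrite !inE eqxx orbT.
pose sub t (tS : t \in S) : {t | t \in S} := exist _ t tS.
have cS : #|{: {t : V | t \in S}}| = #|S| by rewrite card_sig.
have uS : uniq [:: x; y; z] -> #|S| = 3.
  move=> U; have /= <- := card_uniqP U; apply: eq_card => t.
  by rewrite !inE -orbA.
split=> [[H [[T3 [a [b [c /and3P[ab bc ac]]]] E5] le]]|[xy yz xz ge5]].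
  have U3 : uniq [:: x; y; z].
    apply/card_uniqP; rewrite /= -T3 cS.
    by apply: eq_card => t; rewrite !inE -orbA.
  have U : uniq [:: sub x xS; sub y yS; sub z zS].
    by rewrite -(map_inj_uniq val_inj).
  have adj u v : u != v -> 0 < H u v.
    have Uabc : uniq [:: a; b; c].
      by rewrite /= !inE negb_or (nq _ _ _ _ ab) (nq _ _ _ _ bc) (nq _ _ _ _ ac).
    have all3 := mem_uniq3 T3 Uabc.
    move: ab bc ac; rewrite /adjacent => ab bc ac.
    have := all3 u; have := all3 v; rewrite !inE.
    by case/or3P => /eqP-> /or3P[] /eqP->; rewrite ?eqxx // multC.
  have n3 := nb_edges3 H T3 U.
  move: U; rewrite /= !inE negb_or => /and3P[/andP[nxy nxz] nyz _].
  have := (le (sub x xS) (sub y yS), le (sub y yS) (sub z zS),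
           le (sub x xS) (sub z zS)).
  have := (adj _ _ nxy, adj _ _ nyz, adj _ _ nxz).
  rewrite /adjacent /= => -[[h1 h2] h3] -[[l1 l2] l3].
  split; [exact: leq_trans l1 | exact: leq_trans l2 | exact: leq_trans l3 |].
  by rewrite -E5 n3 !leq_add.
have nxy := nq _ _ _ _ xy; have nyz := nq _ _ _ _ yz; have nxz := nq _ _ _ _ xz.
have U3 : uniq [:: x; y; z] by rewrite /= !inE negb_or nxy nxz nyz.
have [a [b [c [a0 b0 c0]]]] : exists a b c, [/\ 0 < a <= M x y, 0 < b <= M y z,
    0 < c <= M x z & a + b + c = 5].
  move: xy yz xz ge5; rewrite /adjacent.
  move: (M x y) (M y z) (M x z) => p q r p0 q0 r0 pqr.
  pose a := minn p 3; pose b := minn q (4 - a).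
  exists a, b, (5 - a - b); rewrite /b /a; split; lia.
pose f (u v : V) := if [set u; v] == [set x; y] then a else
  if [set u; v] == [set y; z] then b else
  if [set u; v] == [set x; z] then c else 0.
have fC u v : f u v = f v u by rewrite /f setUC.
have f0 u : f u u = 0.
  have h p q : p != q -> ([set u; u] == [set p; q]) = false.
    move=> npq; apply/eqP => /(congr1 (fun A : {set V} => #|A|)).
    by rewrite !cards2 eqxx npq.
  by rewrite /f !h.
have e1 : ([set y; z] == [set x; y]) = false.
  by apply/eqP/setP => /(_ x); rewrite !inE eqxx (negPf nxy) (negPf nxz).
have e2 : ([set x; z] == [set x; y]) = false.
  by apply/eqP/setP => /(_ y); rewrite !inE eqxx orbT eq_sym (negPf nxy) (negPf nyz).
have e3 : ([set x; z] == [set y; z]) = false.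
  by apply/eqP/setP => /(_ x); rewrite !inE eqxx (negPf nxy) (negPf nxz).
have fxy : f x y = a by rewrite /f eqxx.
have fyz : f y z = b by rewrite /f e1 eqxx.
have fxz : f x z = c by rewrite /f e2 e3 eqxx.
clearbody f => s5.
exists (@Multigraph {t : V | t \in S} (fun u v => f (val u) (val v))
  (fun u v => fC _ _) (fun u => f0 _)); split.
  have T3 : #|{: {t : V | t \in S}}| = 3 by rewrite cS uS.
  split=> //.
    exists (sub x xS), (sub y yS), (sub z zS).
    rewrite /adjacent /= fxy fyz fxz.
    by case/andP: a0 => ->; case/andP: b0 => ->; case/andP: c0 => ->.
  rewrite (@nb_edges3 _ _ (sub x xS) (sub y yS) (sub z zS)) //.
  by rewrite /= fxy fyz fxz.
move=> [u uS'] [v vS'] /=; move: uS' vS'; rewrite !inE -!orbA.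
have [la lb lc] : [/\ f x y <= M x y, f y z <= M y z & f x z <= M x z].
  by rewrite fxy fyz fxz; case/andP: a0; case/andP: b0; case/andP: c0.
case/or3P => /eqP-> /or3P[] /eqP->; rewrite ?f0 //.
- by rewrite fC multC.
- by rewrite fC multC.
- by rewrite fC multC.
Qed.

(* Main.v *)
(** The proof is by induction on the number of edges missing from [M]: adding one
    edge [xy] gives a tiling of the larger multigraph, hence in [M] disjoint
    5-triangles together with one further triple [A] carrying 4 edges.  Up to order
    [A = {x, y, z}] has multiplicities (xy, xz, yz) equal to (2, 1, 1) or (0, 2, 2).
    Count the edges leaving [A], weighting x, y, z by 1, 1, 2 in the first case and
    by 3, 3, 2 in the second.  If every vertex outside these triples and every
    5-triangle received little weight, the degrees in [A] would be too small.  An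
    outside vertex receiving enough weight forms a 5-triangle with two vertices of
    [A]; a 5-triangle [B] receiving enough weight can be repartitioned together with
    [A] into two 5-triangles, by a finite check on six vertices. *)
Require Import Defs.
From mathcomp Require Import all_boot all_order all_algebra.
From mathcomp Require Import zify lra.

Set Implicit Arguments.
Unset Strict Implicit.
Unset Printing Implicit Defensive.

(** * Triples of vertices and tilings *)

Definition vertices (T : Type) (t : T * T * T) : seq T :=
  [:: t.1.1; t.1.2; t.2].

Definition weight (V : finType) (M : multigraph V) (t : V * V * V) : nat :=
  M t.1.1 t.1.2 + M t.1.2 t.2 + M t.1.1 t.2.

Definition cover_seq (T : Type) (ts : seq (T * T * T)) : seq T :=
  flatten (map (@vertices T) ts).

Definition tiling (V : finType) (M : multigraph V) (ts : seq (V * V * V)) : bool :=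
  uniq (cover_seq ts) && all (fun t => 5 <= weight M t) ts.

Lemma cover_seq_cons (T : Type) (t : T * T * T) (ts : seq (T * T * T)) :
  cover_seq (t :: ts) = vertices t ++ cover_seq ts.
Proof. by []. Qed.

Lemma size_cover_seq (T : Type) (ts : seq (T * T * T)) :
  size (cover_seq ts) = 3 * size ts.
Proof. by elim: ts => //= t ts; rewrite /cover_seq /= => ->; lia. Qed.

Lemma perm_cover_seq (T : eqType) (ts ts' : seq (T * T * T)) :
  perm_eq ts ts' -> perm_eq (cover_seq ts) (cover_seq ts').
Proof. by move=> E; apply/perm_flatten/perm_map. Qed.

Lemma mem_cover_seq (T : eqType) (ts : seq (T * T * T)) t u :
  t \in ts -> u \in vertices t -> u \in cover_seq ts.
Proof. by move=> tts ut; apply/flattenP; exists (vertices t) => //; apply: map_f. Qed.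

Lemma cover_seq_chunk (T : Type) (k : nat) (s : seq T) :
  size s = 3 * k -> exists2 ts, cover_seq ts = s & size ts = k.
Proof.
elim: k s => [|k IH] s; first by case: s => // _; exists [::].
case: s => [|a [|b [|c s]]] /= E; try lia.
have [|ts <- <-] := IH s; first lia.
by exists ((a, b, c) :: ts).
Qed.

(** * Finite check on six vertices, and weighted averaging *)

Definition below3 (P : nat -> bool) : bool := all P [:: 0; 1; 2].

Lemma below3P P : below3 P -> forall i, i <= 2 -> P i.
Proof. by case/and4P=> ? ? ? _ [|[|[|]]]. Qed.

(* The splittings of {x, y, z} and {a, b, c} obtained by swapping one vertex of the
   first triple with one of the second; [xa] is the multiplicity of the pair x, a. *)
Definition can_split (xy xz yz ab bc ac xa xb xc ya yb yc za zb zc : nat) : bool :=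
  let g i j k := 4 < i + j + k in
  [|| g xy xa ya && g zb zc bc, g xy xb yb && g za zc ac, g xy xc yc && g za zb ab,
      g xz xa za && g yb yc bc, g xz xb zb && g ya yc ac, g xz xc zc && g ya yb ab,
      g yz ya za && g xb xc bc, g yz yb zb && g xa xc ac | g yz yc zc && g xa xb ab].

(** In a standard multigraph the twelve pairs meeting the second triple have multiplicities in 0, 1,
    2. Branching with [if] rather than [||] lets call-by-value evaluation skip the inner loops when
    that triple is too light. *)
Definition check_split (xy xz yz w wz bound : nat) : bool :=
  below3 (fun ab => below3 (fun bc => below3 (fun ac =>
  if ab + bc + ac < 5 then true else
  below3 (fun xa => below3 (fun xb => below3 (fun xc =>
  below3 (fun ya => below3 (fun yb => below3 (fun yc =>
  below3 (fun za => below3 (fun zb => below3 (fun zc =>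
  if w * (xa + xb + xc + (ya + yb + yc)) + wz * (za + zb + zc) <= bound then true
  else can_split xy xz yz ab bc ac xa xb xc ya yb yc za zb zc)))))))))))).

Lemma check_split_211 : check_split 2 1 1 1 2 (3 * 6).
Proof. by vm_compute. Qed.

(* The weights (3, 3, 2) are forced up to scaling: there are non-splittable
   configurations where B misses 4 edges to {x, y} and none to z, or 2 and 3, or
   0 and 6. *)
Lemma check_split_022 : check_split 0 2 2 3 2 (3 * 12).
Proof. by vm_compute. Qed.

(** Averaging: if each triple of [ts] received at most [3 * c] and each uncovered vertex at most
    [c], the vertices outside [A] would receive at most [c * (#|V| - 3)] and [A] less than [2 * c],
    a total below [c * #|V|.-1]. *)
Lemma heavy_part (V : finType) (F : V -> nat) (c : nat) (A : V * V * V)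
    (ts : seq (V * V * V)) :
  uniq (cover_seq (A :: ts)) ->
  c * #|V|.-1 <= \sum_v F v ->
  \sum_(v <- vertices A) F v < 2 * c ->
  (exists2 t, t \in ts & 3 * c < \sum_(v <- vertices t) F v) \/
  (exists2 v, v \notin cover_seq (A :: ts) & c < F v).
Proof.
move=> U large smallA.
case: (boolP (has (fun t => 3 * c < \sum_(v <- vertices t) F v) ts)).
  by case/hasP=> t; left; exists t.
rewrite -all_predC => /allP small_ts.
case: (boolP [exists v, (v \notin cover_seq (A :: ts)) && (c < F v)]).
  by case/existsP=> v /andP[]; right; exists v.
rewrite negb_exists => /forallP small_out; exfalso.
have sumS : \sum_(v <- cover_seq ts) F v <= 3 * c * size ts.
  elim: ts small_ts {U small_out} => [|t ts IH] h; first by rewrite big_nil.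
  rewrite cover_seq_cons big_cat /=.
  have := IH (fun u uts => h u (mem_behead (s := t :: ts) uts)).
  have := h t (mem_head _ _); rewrite /= -leqNgt => h1 h2.
  rewrite mulnS; exact: leq_add.
have sumO : \sum_(v | v \notin cover_seq (A :: ts)) F v
    <= c * (#|V| - size (cover_seq (A :: ts))).
  have -> : #|V| - size (cover_seq (A :: ts)) = #|[predC cover_seq (A :: ts)]|.
    by rewrite -(card_uniqP U) -(cardC (mem (cover_seq (A :: ts)))) addKn.
  rewrite mulnC -sum_nat_const; apply: leq_sum => v vO.
  by have := small_out v; rewrite vO -leqNgt.
have le_n : size (cover_seq (A :: ts)) <= #|V|.
  by rewrite -(card_uniqP U) max_card.
move: large; rewrite (bigID (mem (cover_seq (A :: ts)))) /= -big_uniq //=.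
rewrite {1}cover_seq_cons big_cat.
move: sumO le_n; rewrite size_cover_seq [size _]/=.
move: sumS smallA.
set s1 := \sum_(v <- cover_seq ts) _; set s2 := \sum_(v | _) _.
set s3 := \sum_(v <- vertices A) _; move: #|V| => n.
rewrite /= => small_S small_A small_O le_n large.
(* Multiplied by [c], the size bound ensures that the distributed subtraction does not truncate. *)
have := leq_mul (leqnn c) le_n; move: small_S small_O large.
rewrite mulnBr -subn1 mulnBr muln1 mulnS mulnDr mulnA [c * 3]mulnC.
lia.
Qed.

(** After [permP], a permutation is an equality of counts of an arbitrary predicate; with its truth
    values abstracted to naturals, this is linear arithmetic. *)
Ltac perm_lia :=
  rewrite /=; clear; repeat match goal with
  | |- context [nat_of_bool ?b] => move: (nat_of_bool b) => ?
  end; lia.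

(** * Exchanges that absorb a triple of weight 4 *)

Section Tilings.

Variables (V : finType) (M : multigraph V).
Hypothesis stdM : standard M.

Lemma split_six (x y z : V) (t : V * V * V) (w wz bound : nat) :
  check_split (M x y) (M x z) (M y z) w wz bound ->
  5 <= weight M t ->
  bound < \sum_(v <- vertices t) (w * (M x v + M y v) + wz * M z v) ->
  exists t1 t2, [/\ 5 <= weight M t1, 5 <= weight M t2 &
    perm_eq (cover_seq [:: t1; t2]) (cover_seq [:: (x, y, z); t])].
Proof.
case: t => -[a b] c chk; rewrite /weight /= => wt.
rewrite !big_cons big_nil /= => lt_bound.
have := chk; move/below3P/(_ _ (stdM a b))/below3P/(_ _ (stdM b c)).
move/below3P/(_ _ (stdM a c)); rewrite ltnNge wt /=.
move/below3P/(_ _ (stdM x a))/below3P/(_ _ (stdM x b))/below3P/(_ _ (stdM x c)).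
move/below3P/(_ _ (stdM y a))/below3P/(_ _ (stdM y b))/below3P/(_ _ (stdM y c)).
move/below3P/(_ _ (stdM z a))/below3P/(_ _ (stdM z b))/below3P/(_ _ (stdM z c)).
rewrite ifF; last by apply/negbTE; rewrite -ltnNge; apply: leq_trans lt_bound _; nia.
rewrite /can_split.
(* The first premise says that the new triples use the same multiset of vertices as the old ones, in
   a form linear in the values of [P]. *)
have E p q v r u u' :
    (forall P : V -> nat, P p + P q + P v + P r + P u + P u' =
       P x + P y + P z + P a + P b + P c) ->
    4 < M p q + M p v + M q v -> 4 < M r u + M r u' + M u u' ->
    exists t1 t2, [/\ 5 <= weight M t1, 5 <= weight M t2 &
      perm_eq (cover_seq [:: t1; t2]) (cover_seq [:: (x, y, z); (a, b, c)])].
  move=> C w1 w2; exists (p, q, v), (r, u, u'); rewrite /weight /=.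
  split; [lia | lia |].
  by apply/permP => P; have /= := C P; rewrite /cover_seq; perm_lia.
by clear - E; do 8 ?[case/orP]; case/andP; apply: E => // P; clear; lia.
Qed.

(** Edges at [x] and [y] get weight [w], those at [z] weight [wz]. The choice of [c] turns the
    degree bound into a total weight of at least [c * #|V|.-1]; the fourth hypothesis bounds the
    weight that the triple sends to itself. *)
Lemma exchange (x y z : V) (w wz c : nat) (ts : seq (V * V * V)) :
  check_split (M x y) (M x z) (M y z) w wz (3 * c) ->
  3 * (2 * w + wz) = 2 * c ->
  (forall v, 3 * #|V|.-1 <= 2 * degree M v) ->
  2 * (w * M x y) + (w + wz) * (M x z + M y z) < 2 * c ->
  (forall v, c < w * (M x v + M y v) + wz * M z v ->
    exists p q r, [/\ 5 <= weight M (p, q, v) & perm_eq [:: p; q; r] [:: x; y; z]]) ->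
  uniq (cover_seq ((x, y, z) :: ts)) -> all (fun t => 5 <= weight M t) ts ->
  exists2 ts', tiling M ts' & size ts' = (size ts).+1.
Proof.
move=> chk c_def deg smallA attach U good.
have [|||] := @heavy_part _ (fun v => w * (M x v + M y v) + wz * M z v) c _ _ U.
- rewrite big_split /= -!big_distrr /= big_split /= -!/(degree M _).
  have := (leq_mul (leqnn w) (deg x), leq_mul (leqnn w) (deg y)).
  have := leq_mul (leqnn wz) (deg z); have := congr1 (muln^~ #|V|.-1) c_def.
  clear; move: #|V|.-1 (degree M x) (degree M y) (degree M z) => m dx dy dz.
  by move=> e lez [lex ley]; lia.
- rewrite !big_cons big_nil /= !mult_irr (multC M y x) (multC M z x) (multC M z y).
  by move: smallA; lia.
- case=> t tts lt_t.
  have [|t1 [t2 [g1 g2 E]]] := @split_six x y z t w wz (3 * c) chk _ lt_t.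
    exact: (allP good).
  have E1 := perm_to_rem tts.
  exists [:: t1, t2 & rem t ts]; last by rewrite (perm_size E1).
  apply/andP; split; last first.
    by rewrite /= g1 g2; move: good; rewrite (perm_all _ E1) => /andP[].
  have cat2 (p q : V * V * V) s : cover_seq [:: p, q & s] = cover_seq [:: p; q] ++ cover_seq s by [].
  move: U; rewrite (perm_uniq (perm_cover_seq (_ : perm_eq _ [:: (x, y, z), t & rem t ts]))).
    rewrite -(perm_uniq (_ : perm_eq (cover_seq [:: t1, t2 & rem t ts]) _)) //.
    by rewrite 2!(cat2 _ _ (rem t ts)) perm_cat2r.
  by rewrite perm_cons.
- case=> v vO /attach[p [q [r [g E]]]].
  exists ((p, q, v) :: ts); last by [].
  apply/andP; split; last by rewrite /= g.
  have : uniq (v :: cover_seq ((x, y, z) :: ts)) by rewrite cons_uniq vO.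
  (* [v] replaces [r], which becomes uncovered. *)
  have E' : perm_eq (v :: cover_seq ((x, y, z) :: ts))
      (r :: cover_seq ((p, q, v) :: ts)).
    by apply/permP => P; have /permP/(_ P) := E; rewrite /cover_seq; perm_lia.
  by rewrite (perm_uniq E') => /andP[].
Qed.

Lemma exchange_ordered (x y z : V) (ts : seq (V * V * V)) :
  (forall v, 3 * #|V|.-1 <= 2 * degree M v) ->
  weight M (x, y, z) = 4 -> M x z = M y z ->
  uniq (cover_seq ((x, y, z) :: ts)) -> all (fun t => 5 <= weight M t) ts ->
  exists2 ts', tiling M ts' & size ts' = (size ts).+1.
Proof.
move=> deg; rewrite /weight /= => w4 eq_z U good.
have := (stdM x y, stdM y z) => -[lxy lyz].
have [[exy ez]|[exy ez]] : M x y = 2 /\ M y z = 1 \/ M x y = 0 /\ M y z = 2 by lia.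
- have chk : check_split (M x y) (M x z) (M y z) 1 2 (3 * 6).
    by rewrite exy eq_z ez check_split_211.
  apply: (exchange chk erefl deg _ _ U good); first by rewrite exy eq_z ez.
  (* [z] contributes at most 4 to a total above 6, so [v] sends at least 3 edges to the double edge
     [xy]. *)
  move=> v lt_v; exists x, y, z; split; last by [].
  by rewrite /weight /=; have := stdM z v; lia.
- have chk : check_split (M x y) (M x z) (M y z) 3 2 (3 * 12).
    by rewrite exy eq_z ez check_split_022.
  apply: (exchange chk erefl deg _ _ U good); first by rewrite exy eq_z ez.
  move=> v lt_v; have := (stdM x v, stdM y v, stdM z v) => -[[lx ly] lz].
  (* If both sums were at most 2, three times their total would bound the weight of [v] by 12. *)
  have [h|h] : 3 <= M x v + M z v \/ 3 <= M y v + M z v by lia.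
  + exists x, z, y; rewrite /weight /=; split; first by lia.
    by apply/permP => P; perm_lia.
  + exists y, z, x; rewrite /weight /=; split; first by lia.
    by apply/permP => P; perm_lia.
Qed.

(** Three multiplicities at most 2 with sum 4 include two equal ones; the common end of those two
    pairs is taken as [z]. *)
Lemma exchange4 (t : V * V * V) (ts : seq (V * V * V)) :
  (forall v, 3 * #|V|.-1 <= 2 * degree M v) ->
  weight M t = 4 -> uniq (cover_seq (t :: ts)) ->
  all (fun t => 5 <= weight M t) ts ->
  exists2 ts', tiling M ts' & size ts' = (size ts).+1.
Proof.
case: t => -[x y] z deg; rewrite /weight /= => w4 U good.
have U' p q r : perm_eq [:: x; y; z] [:: p; q; r] -> uniq (cover_seq ((p, q, r) :: ts)).
  move=> E; rewrite -(perm_uniq (s1 := cover_seq ((x, y, z) :: ts))) //.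
  by rewrite !cover_seq_cons perm_cat2r.
have := (stdM x y, stdM y z, stdM x z) => -[[lxy lyz] lxz].
have := (multC M x y, multC M y z, multC M x z) => -[[cxy cyz] cxz].
have [e|[e|e]] : M x z = M y z \/ M x y = M y z \/ M x y = M x z by lia.
- by apply: exchange_ordered U good => //; rewrite /weight /=; lia.
- apply: (exchange_ordered (x := x) (y := z) (z := y)) good => //; first 1 last.
  + lia.
  + by apply: U'; apply/permP => P; perm_lia.
  + by rewrite /weight /=; lia.
- apply: (exchange_ordered (x := y) (y := z) (z := x)) good => //; first 1 last.
  + lia.
  + by apply: U'; apply/permP => P; perm_lia.
  + by rewrite /weight /=; lia.
Qed.

End Tilings.

(** * Adding an edge, and induction on the missing edges *)

Definition edge_mult (V : finType) (x y u v : V) : nat :=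
  (((u == x) && (v == y)) || ((u == y) && (v == x)) : bool).

Lemma add_edge (V : finType) (M : multigraph V) (x y : V) : x != y ->
  {M' : multigraph V | forall u v, M' u v = M u v + edge_mult x y u v}.
Proof.
move=> nxy.
have C u v : M u v + edge_mult x y u v = M v u + edge_mult x y v u.
  by rewrite multC /edge_mult orbC ![(v == _) && _]andbC.
have I u : M u u + edge_mult x y u u = 0.
  rewrite mult_irr /edge_mult andbC orbb.
  by case: eqP => // ->; rewrite eq_sym (negPf nxy).
by exists (Multigraph C I).
Qed.

(** The bound is by membership of [x] because disjoint triples contain [x] at most once, so at most
    one of them can use the added edge. *)
Lemma edge_mult_tri (V : finType) (x y a b c : V) : uniq [:: a; b; c] ->
  edge_mult x y a b + edge_mult x y b c + edge_mult x y a c <=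
    (x \in [:: a; b; c]).
Proof.
rewrite /= !inE negb_or andbT /edge_mult => /andP[/andP[ab ac] bc].
rewrite !(eq_sym x).
have [ax|ax] := eqVneq a x; have [bx|bx] := eqVneq b x; have [cx|cx] := eqVneq c x;
 have [ay|ay] := eqVneq a y; have [by'|by'] := eqVneq b y; have [cy|cy] := eqVneq c y;
 subst; rewrite ?eqxx // in ab ac bc *.
Qed.

(** For standard [M], each missing edge counts twice and each diagonal entry adds a constant 2; only
    the strict decrease matters. *)
Definition missing (V : finType) (M : multigraph V) : nat :=
  \sum_(u : V) \sum_(v : V) (2 - M u v).

Lemma tiling_exists (V : finType) (M : multigraph V) (k : nat) :
  standard M -> 3 * k <= #|V| ->
  (forall v, 3 * #|V|.-1 <= 2 * degree M v) ->
  exists2 ts, tiling M ts & size ts = k.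
Proof.
move=> + le_k.
have [m] := ubnP (missing M); elim: m M => // m IH M lt_m stdM deg.
case: (boolP [exists x, exists y, (x != y) && (M x y < 2)]); last first.
  (* With every pair doubled, any [k] disjoint triples form a tiling. *)
  move=> full.
  have {}full x y : x != y -> 2 <= M x y.
    move=> nxy; rewrite leqNgt; apply: contra full => lxy.
    by apply/existsP; exists x; apply/existsP; exists y; rewrite nxy.
  have [|ts cov <-] := @cover_seq_chunk _ k (take (3 * k) (enum V)).
    by rewrite size_takel // -cardE.
  exists ts => //; apply/andP; rewrite cov take_uniq ?enum_uniq //; split=> //.
  have : uniq (cover_seq ts) by rewrite cov take_uniq ?enum_uniq.
  elim: ts {cov} => // -[[a b] c] ts IHts.
  rewrite cover_seq_cons cat_uniq.
  case/and3P=> /= + _ /IHts->; rewrite !inE negb_or !andbT /weight /=.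
  by case/andP=> /andP[/full ab /full ac] /full bc; lia.
case/existsP=> x /existsP[y /andP[nxy lt2]].
have [M' M'E] := add_edge M nxy.
have leM u v : M u v <= M' u v by rewrite M'E leq_addr.
have stdM' : standard M'.
  move=> u v; rewrite M'E /edge_mult.
  have [/orP[]/andP[/eqP-> /eqP->]|_] := boolP (_ || _); rewrite ?addn0 ?addn1 //.
  by rewrite multC.
have deg' v : 3 * #|V|.-1 <= 2 * degree M' v.
  by apply: leq_trans (deg v) _; rewrite leq_mul2l; apply: leq_sum => u _.
have lt' : missing M' < m.
  suff: missing M' < missing M by lia.
  have lexy : M' x y = (M x y).+1 by rewrite M'E /edge_mult !eqxx addn1.
  (* The entry at [x], [y] drops strictly and the others do not grow. *)
  rewrite /missing [ltnLHS](bigD1 x) // [ltnRHS](bigD1 x) //=.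
  rewrite [in ltnLHS](bigD1 y) //= [in ltnRHS](bigD1 y) //= lexy.
  apply: (@leq_add (_.+1)); last by apply: leq_sum => u _; apply: leq_sum => v _; apply: leq_sub2l.
  apply: (@leq_add (_.+1)); last by apply: leq_sum => v _; apply: leq_sub2l.
  by lia.
have [ts /andP[U good'] sz] := IH M' lt' stdM' deg'.
case: (boolP (all (fun t => 5 <= weight M t) ts)) => [good|].
  by exists ts => //; apply/andP.
case/allPn=> -[[a b] c] tts; rewrite -ltnNge => bad.
have E := perm_to_rem tts.
have := U; rewrite (perm_uniq (perm_cover_seq E)) => Ut.
have w_le p q r : uniq [:: p; q; r] ->
    weight M' (p, q, r) <= weight M (p, q, r) + (x \in [:: p; q; r]).
  by move/(edge_mult_tri x y); rewrite /weight /= !M'E; lia.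
have uniq_in t : t \in ts -> uniq (vertices t).
  by move/perm_to_rem/perm_cover_seq/perm_uniq; rewrite U => /esym; rewrite cat_uniq => /and3P[].
have := allP good' _ tts; have := w_le a b c (uniq_in _ tts) => h1 h2.
(* Deleting the new edge costs at most 1, and only in a triple containing [x]; so the bad triple
   contains [x] and has weight exactly 4 in [M]. *)
have xabc : x \in [:: a; b; c].
  by apply: contraT => /negPf nx; move: h1 h2 bad; rewrite nx /=; lia.
have [|||ts' til' sz'] := @exchange4 _ M stdM (a, b, c) (rem (a, b, c) ts) deg.
- by move: h1 h2 bad; rewrite xabc /=; lia.
- exact: Ut.
(* The other triples avoid [x], hence keep their weight in [M]. *)
- apply/allP => -[[p q] r] trem.
  have tin := mem_rem trem.
  have := allP good' _ tin; have := w_le p q r (uniq_in _ tin).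
  suff /negPf-> : x \notin [:: p; q; r].
    by rewrite addn0 => le_w lt_w; apply: leq_trans lt_w le_w.
  move: Ut; rewrite cover_seq_cons cat_uniq => /and3P[_ /hasPn disj _].
  apply: contraL xabc => xin; apply: disj.
  exact: mem_cover_seq trem xin.
by exists ts' => //; rewrite sz' -sz (perm_size E).
Qed.

(** * From tilings to disjoint 5-triangles *)

Definition vertex_set (V : finType) (t : V * V * V) : {set V} :=
  [set t.1.1; t.1.2; t.2].

Lemma in_vertex_set (V : finType) (t : V * V * V) v :
  (v \in vertex_set t) = (v \in vertices t).
Proof. by rewrite !inE orbA. Qed.

Lemma tiling_disjoint (V : finType) (M : multigraph V) (ts : seq (V * V * V)) :
  standard M -> tiling M ts -> contains_disjoint_five_triangles M (size ts).
Proof.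
move=> stdM /andP[U /allP good].
(* This gives both the disjointness of the vertex sets and their being as many as the triples. *)
have disj : {in ts &, forall t u v, v \in vertices t -> v \in vertices u -> t = u}.
  move=> t u tts uts v vt vu; apply/eqP; apply: contraT => ntu.
  move: U; rewrite (perm_uniq (perm_cover_seq (perm_to_rem tts))).
  rewrite cover_seq_cons cat_uniq.
  case/and3P=> _ /hasPn/(_ v) + _; rewrite vt => /(_ _)/negP[] //.
  apply: mem_cover_seq vu; have := uts.
  by rewrite (perm_mem (perm_to_rem tts)) inE eq_sym (negPf ntu).
have inj : {in ts &, injective (@vertex_set V)}.
  move=> t u tts uts /setP/(_ t.2); rewrite !in_vertex_set.
  have vt : t.2 \in vertices t by rewrite !inE eqxx !orbT.
  by rewrite vt => /esym; apply: disj.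
have uts : uniq ts.
  elim: ts U {good disj inj} => // t ts IH.
  rewrite cover_seq_cons cat_uniq.
  case/and3P=> _ /hasPn h /IH /= ->; rewrite andbT.
  apply/negP => tts; have vt : t.2 \in vertices t by rewrite !inE eqxx !orbT.
  by have := h _ (mem_cover_seq tts vt); rewrite /= vt.
exists [set vertex_set t | t in ts]; split.
- by rewrite card_in_imset // (card_uniqP uts).
- apply/trivIsetP => _ _ /imsetP[t tts ->] /imsetP[u uts' ->].
  apply: contraR => /pred0Pn[v /andP[]]; rewrite /= !in_vertex_set => vt vu.
  by rewrite (disj _ _ tts uts' v vt vu).
- move=> _ /imsetP[[[a b] c] tts ->]; apply/contains_five_triangle_onP.
  have := good _ tts; rewrite /weight /adjacent /=.
  (* A sum of at least 5 with terms at most 2 makes every term positive. *)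
  by have := (stdM a b, stdM b c, stdM a c) => -[[]]; split; lia.
Qed.

Theorem theorem13 (n : nat) (V : finType) (M : multigraph V) :
  #|V| = n ->
  standard M ->
  (((3 * n%:R - 3) / 2 : rat) <= (min_degree M)%:R)%R ->
  contains_disjoint_five_triangles M (n %/ 3).
Proof.
move=> Vn stdM deg.
have deg_nat : 3 * n.-1 <= 2 * min_degree M.
  (* For [n = 0] the truncated predecessor makes the left side 0. *)
  case: n {Vn} deg => [|n] //= deg.
  have : ((3 * n)%:R <= (2 * min_degree M)%:R :> rat)%R.
    by rewrite !GRing.natrM; move: deg; rewrite -GRing.natr1; lra.
  by rewrite Num.Theory.ler_nat.
have [|v|ts til <-] := @tiling_exists V M (n %/ 3) stdM.
- by rewrite Vn mulnC leq_trunc_div.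
- by rewrite Vn; apply: leq_trans deg_nat _; rewrite leq_mul2l min_degree_le orbT.
exact: tiling_disjoint.
Qed.
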